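(* Let $X_1$ ($n\times p_1$) and $X_2$ ($n\times p_2$), $p_1,p_2>0$, $p=p_1+p_2$, be such that $X=(X_1,X_2)$ has full column rank and centered columns. Consider the models $M_1: y=\alpha\mathbf 1+X_1\beta_1+\epsilon$ and $M_2: y=\alpha\mathbf 1+X_1\beta_1+X_2\beta_2+\epsilon$, $\epsilon\sim N(0,\sigma^2I_n)$, each equipped with the robust prior of Bayarri et al. with hyperparameters $a_r=1/2$, $b=1$, $\rho=1/(p_\gamma+1)$ (where $p_\gamma$ is the number of predictors in the model). Suppose $n>p_1+2$. Consider the sequence of problems $\Psi_N$ with data $y_N=\alpha\mathbf 1+X_1\beta_{1(N)}+X_2\beta_2+\epsilon$, where $X_1,X_2,\alpha,\beta_2,\epsilon$ are held fixed and $\|\beta_{1(N)}\|\to\infty$. Then $BF(M_2:M_1)\to0$ as $N\to\infty$, irrespective of the data.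
   Context: Robust prior for a model with $n\times p_\gamma$ centered design $X_\gamma$: $\pi(\alpha,\sigma^2)\propto1/\sigma^2$; $\beta_\gamma\mid g,\sigma^2\sim N(0,g\sigma^2(X_\gamma^TX_\gamma)^{-1})$; $g$ has density $\pi(g)=a_r[\rho(b+n)]^{a_r}(g+b)^{-(a_r+1)}$ for $g>\rho(b+n)-b$ (and $0$ otherwise). The Bayes factor $BF(M_2:M_1)=p(y\mid M_2)/p(y\mid M_1)$ is the ratio of marginal likelihoods. The response is centered.
   Formalization: The Bayes factor is taken as 0 when a marginal likelihood is infinite (X2β2+ε in the span of 1 and X1, or ε in the span of 1, X1, X2 with n ≥ p+2); for such data it is actually infinite or undefined, so ''irrespective of the data'' fails there. *)

(* Defs.v *)
From HB Require Import structures.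
From mathcomp Require Import all_boot all_order all_algebra.
From mathcomp Require Import all_classical all_reals all_analysis.
Set Implicit Arguments. Unset Strict Implicit. Unset Printing Implicit Defensive.
Import Order.TTheory GRing.Theory Num.Theory.
Import numFieldNormedType.Exports.
Local Open Scope classical_set_scope.
Local Open Scope ring_scope.

Section Defs.
Variable R : realType.

Local Notation leb := (@lebesgue_measure R).

Fixpoint int_cV (p : nat) : ('cV[R]_p -> \bar R) -> \bar R :=
  match p with
  | 0%N => fun f => f 0
  | p'.+1 => fun f =>
      (\int[leb]_x int_cV (fun v : 'cV[R]_p' =>
          f (col_mx (\col_(i < 1) x) v : 'cV[R]_p'.+1)))%E
  end.

Definition enorm (m : nat) (v : 'cV[R]_m) : R :=
  Num.sqrt (\sum_(i < m) (v i 0) ^+ 2).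

Definition lik (n p : nat) (X : 'M[R]_(n, p)) (y : 'cV[R]_n)
    (alpha : R) (beta : 'cV[R]_p) (s2 : R) : R :=
  (2 * pi * s2) `^ (- (n%:R / 2)) *
  expR (- ((enorm (y - alpha *: const_mx 1 - X *m beta)) ^+ 2 / (2 * s2))).

Definition beta_prior (n p : nat) (X : 'M[R]_(n, p)) (g s2 : R)
    (beta : 'cV[R]_p) : R :=
  let Sigma := (g * s2) *: invmx (X^T *m X) in
  (2 * pi) `^ (- (p%:R / 2)) * (\det Sigma) `^ (- (1 / 2)) *
  expR (- ((beta^T *m invmx Sigma *m beta) 0 0 / 2)).

Definition robust_g_prior (a_r b rho : R) (n : nat) (g : R) : R :=
  if rho * (b + n%:R) - b < g then
    a_r * (rho * (b + n%:R)) `^ a_r * (g + b) `^ (- (a_r + 1))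
  else 0.

(* Marginal likelihood p(y | M_gamma) for the model with design X (n x p)
   under the robust prior with a_r = 1/2, b = 1, rho = 1/(p+1), and
   pi(alpha, sigma^2) = 1/sigma^2 (for sigma^2 > 0). *)
Definition marg_lik (n p : nat) (X : 'M[R]_(n, p)) (y : 'cV[R]_n) : \bar R :=
  (\int[leb]_g
    \int[leb]_s2
      \int[leb]_alpha
        int_cV (fun beta : 'cV[R]_p =>
          ((robust_g_prior (1/2) 1 (p.+1%:R)^-1 n g *
            (if 0 < s2 then s2^-1 else 0) *
            lik X y alpha beta s2 *
            beta_prior X g s2 beta)%:E)))%E.

Definition bayes_factor (n p1 p2 : nat) (X2 : 'M[R]_(n, p2)) (X1 : 'M[R]_(n, p1))
    (y : 'cV[R]_n) : R :=
  fine (marg_lik X2 y) / fine (marg_lik X1 y).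

End Defs.

(* Main.v *)
(* With X centered of full rank and y = mu 1 + X b + r, where r is orthogonal to
   1 and to X, completing squares shows that the marginal likelihood is, up to
   factors depending only on X, the integral over g of
     (1 + g)^(-(p+3)/2) (|r|^2 + |X b|^2 / (1 + g))^(-(n-1)/2).
   When |beta_1| grows, |r|^2 stays fixed in both models, while |X b|^2 is of the
   order of W = |X_1 beta_1|^2.  Restricting to 1 + g of order W bounds p(y | M_1)
   below by a multiple of W^(-(p_1+1)/2).  Splitting the power of the sum
   |r|^2 + |X b|^2 / (1 + g) between its two terms bounds p(y | M_2) above
   by a multiple of W^(-c) for some c > (p_1+1)/2.  If the marginal likelihood of
   M_1 or of M_2 diverges, its [fine] part is 0, hence (as x / 0 = 0) so is the
   quotient. *)
Require Import Defs.
From HB Require Import structures.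
From mathcomp Require Import all_boot all_order all_algebra.
From mathcomp Require Import all_classical all_reals all_analysis.
From mathcomp Require Import measurable_realfun ring lra.
Set Implicit Arguments. Unset Strict Implicit. Unset Printing Implicit Defensive.
Import Order.TTheory GRing.Theory Num.Theory.
Import numFieldNormedType.Exports.
Local Open Scope classical_set_scope.
Local Open Scope ring_scope.

Section Monotonicity.
Import HBNNSimple.

(* Unlike [ge0_le_integral], no measurability is required: the integral of a
   nonnegative function is a supremum over the simple functions below it. *)
Lemma ge0_le_integral_setT d (T : measurableType d) (R : realType)
    (mu : {measure set T -> \bar R}) (f g : T -> \bar R) :
  (forall x, 0 <= f x)%E -> (forall x, f x <= g x)%E ->
  (\int[mu]_x f x <= \int[mu]_x g x)%E.
Proof.
move=> f0 fg; have g0 x : (0 <= g x)%E by exact: le_trans (f0 x) (fg x).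
rewrite !ge0_integralTE//; apply: ereal_sup_le => _ [h hf <-].
by exists h => // x; exact: le_trans (hf x) (fg x).
Qed.

End Monotonicity.

Section Integrals.
Variable R : realType.
Local Notation leb := (@lebesgue_measure R).

Lemma integral_if_in (D : set R) (P : pred R) (f : R -> \bar R) :
  (forall x, D x <-> P x) ->
  (\int[leb]_(x in D) f x = \int[leb]_x (if P x then f x else 0))%E.
Proof.
move=> DP; rewrite integral_mkcond; apply: eq_integral => x _.
rewrite /patch; case: ifPn.
  by rewrite inE => /DP ->.
by move=> h; case: ifPn => // /DP; rewrite -in_setE (negbTE h).
Qed.

Lemma integral_itv_ge (a b c : R) (f : R -> \bar R) :
  a <= b -> 0 <= c -> (forall x, 0 <= f x)%E ->
  (forall x, (a <= x <= b)%R -> c%:E <= f x)%E ->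
  ((c * (b - a))%:E <= \int[leb]_x f x)%E.
Proof.
move=> ab c0 f0 cf.
apply: (@le_trans _ _ (\int[leb]_(x in `[a, b]) c%:E)%E).
  rewrite integral_cst//= lebesgue_measure_itv/= lte_fin EFinM.
  by move: ab; rewrite le_eqVlt => /predU1P[->|ab];
    rewrite ?ltxx ?ab ?subrr//= EFinB.
rewrite (integral_if_in (P := fun x => a <= x <= b)) => [|x]; last first.
  by rewrite /= in_itv.
apply: ge0_le_integral_setT => x; first by case: ifP => // _; rewrite lee_fin.
by case: ifP => // /cf.
Qed.

Lemma integral_gauss (c a m : R) : 0 <= c -> 0 < a ->
  (\int[leb]_x (c * expR (- (a * (x - m) ^+ 2)))%:E =
   (c * Num.sqrt (pi / a))%:E)%E.
Proof.
move=> c0 a0; have s0 : Num.sqrt (2 * a) != 0 :> R.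
  by rewrite gt_eqF// sqrtr_gt0 mulr_gt0.
pose s := (Num.sqrt (2 * a))^-1.
have s0' : s != 0 by rewrite invr_eq0.
have s2 : s ^+ 2 = (2 * a)^-1 by rewrite exprVn sqr_sqrtr// mulr_ge0// ltW.
have Ek : normal_peak s = (Num.sqrt (pi / a))^-1.
  rewrite /normal_peak s2; congr (Num.sqrt _)^-1.
  rewrite -mulr_natl; field; lra.
have q0 : 0 < Num.sqrt (pi / a) by rewrite sqrtr_gt0 divr_gt0// pi_gt0.
transitivity (\int[leb]_x ((c * Num.sqrt (pi / a))%:E * (normal_pdf m s x)%:E))%E.
  apply: eq_integral => x _; rewrite -EFinM; congr EFin.
  rewrite normal_pdfE//= Ek [RHS]mulrA mulfK ?gt_eqF//.
  rewrite /normal_fun s2; congr (_ * expR _).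
  rewrite -mulr_natl; field; lra.
rewrite ge0_integralZl_EFin//.
- by rewrite integral_normal_pdf mule1.
- by move=> x _; rewrite lee_fin normal_pdf_ge0.
- by apply/measurable_EFinP; exact: measurable_normal_pdf.
- by rewrite mulr_ge0// ltW.
Qed.

Lemma cvgr_powRN (e : R) : 0 < e -> x `^ (- e) @[x --> +oo] --> 0.
Proof.
move=> e0; apply/cvgr0Pnorm_lt => eps eps0; near=> x.
have x1 : eps `^ (- e^-1) < x by near: x; exact: nbhs_pinfty_gt (num_real _).
have x0 : 0 < x by apply: le_lt_trans x1; exact: powR_ge0.
rewrite ger0_norm ?powR_ge0// powRN invf_plt ?posrE ?powR_gt0//.
rewrite -[ltLHS](@powRr1 _ eps^-1) ?invr_ge0 ?ltW//.
rewrite -(powR_inv1 (ltW eps0)) -powRrM mulr1 (_ : -1 = - e^-1 * e); last first.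
  by rewrite mulNr mulVf ?gt_eqF.
by rewrite powRrM gt0_ltr_powR// ?nnegrE ?powR_ge0// ltW.
Unshelve. all: by end_near. Qed.

Lemma integral_powR_tail (d a e : R) : 0 < e -> 0 < d + a ->
  (\int[leb]_(x in `[a, +oo[) ((d + x) `^ (- (1 + e)))%:E =
   ((d + a) `^ (- e) / e)%:E)%E.
Proof.
move=> e0 da.
pose F (x : R) := - ((d + x) `^ (- e) / e).
have pos x : a <= x -> 0 < d + x by move=> ax; lra.
have dP r x : a <= x ->
    is_derive x 1 (fun y => (d + y) `^ r) (r * (d + x) `^ (r - 1)).
  move=> /pos dx; have := is_derive1_powR r dx => dp.
  have := @is_derive1_comp _ (fun y : R => y `^ r) (fun y => d + y) x _ 1 dp.
  rewrite mulr1; apply; rewrite -[X in is_derive _ _ _ X]add0r.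
  exact: is_deriveD.
have dF x : a <= x -> is_derive x 1 F ((d + x) `^ (- (1 + e))).
  move=> /(dP (- e)) dx.
  have -> : F = (fun y => (- e^-1) *: (d + y) `^ (- e) : R).
    by apply/funext => y; rewrite /F -mulNr mulrC scaleNr mulrN -mulNr.
  rewrite (_ : _ `^ _ = - e^-1 *: (- e * (d + x) `^ (- e - 1))).
    exact: is_deriveZ.
  rewrite /GRing.scale/= mulrA mulrNN mulVf ?gt_eqF// mul1r; congr (_ `^ _).
  by ring.
have cvg_at (f : R -> R) x : {for x, continuous f} -> f y @[y --> x^'+] --> f x.
  exact: cvg_at_right_filter.
have cont r x : a <= x -> {for x, continuous (fun y => (d + y) `^ r)}.
  move=> /(dP r) dx; apply: differentiable_continuous.
  by apply/derivable1_diffP; exact: ex_derive.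
rewrite (@ge0_continuous_FTC2y _ _ F _ 0).
- by rewrite add0e /F EFinN oppeK.
- by move=> x _; exact: powR_ge0.
- apply/continuous_within_itvcyP; split; last exact/cvg_at/cont.
  by move=> x; rewrite in_itv/= andbT => /ltW; exact: cont.
- rewrite /F -oppr0; apply: cvgN; rewrite -(mul0r e^-1); apply: cvgMl.
  exact: cvg_comp (cvg_addrl d) (cvgr_powRN e0).
- by move=> x /ltW ax; have := dF _ ax => ?; exact: ex_derive.
- apply: cvg_at; apply: differentiable_continuous; apply/derivable1_diffP.
  by have := dF _ (lexx a) => ?; exact: ex_derive.
- move=> x; rewrite in_itv/= andbT => /ltW ax; rewrite derive1E.
  by have := dF _ ax => ?; exact: derive_val.
Qed.

Lemma measurable_powRDl (D : set R) (d r : R) : measurable D ->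
  measurable_fun D (fun x => (d + x) `^ r).
Proof.
move=> mD; apply: (@measurableT_comp _ _ _ _ _ _ (fun x : R => x `^ r)).
  exact: measurable_powR.
by apply: measurable_funD.
Qed.

Lemma integral_powR_tailZ (c d a e : R) : 0 <= c -> 0 < e -> 0 < d + a ->
  (\int[leb]_(x in `[a, +oo[) (c * (d + x) `^ (- (1 + e)))%:E =
   (c * ((d + a) `^ (- e) / e))%:E)%E.
Proof.
move=> c0 e0 da; rewrite EFinM -integral_powR_tail//.
rewrite -ge0_integralZl_EFin//.
- by move=> x _; rewrite lee_fin powR_ge0.
- apply/measurable_EFinP; exact: measurable_powRDl.
Qed.

Lemma integral_le_in (D : set R) (f g : R -> \bar R) :
  (forall x, 0 <= f x)%E -> (forall x, D x -> f x <= g x)%E ->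
  (forall x, ~ D x -> f x = 0%E) ->
  (\int[leb]_x f x <= \int[leb]_(x in D) g x)%E.
Proof.
move=> f0 fg fD; rewrite [leRHS]integral_mkcond.
apply: ge0_le_integral_setT => // x; rewrite /patch.
case: ifPn => [/set_mem/fg //|/negP xD].
by rewrite fD// => Dx; apply: xD; rewrite inE.
Qed.

Lemma integral_ge_in (D : set R) (f g : R -> \bar R) :
  (forall x, 0 <= f x)%E -> (forall x, D x -> 0 <= g x)%E ->
  (forall x, D x -> g x <= f x)%E ->
  (\int[leb]_(x in D) g x <= \int[leb]_x f x)%E.
Proof.
move=> f0 g0 gf; rewrite [leLHS]integral_mkcond.
apply: ge0_le_integral_setT => x; rewrite /patch.
  by case: ifPn => [/set_mem/g0|].
by case: ifPn => [/set_mem/gf|].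
Qed.

Lemma integral_le_split (D1 D2 : set R) (f g1 g2 : R -> \bar R) :
  measurable D1 -> measurable D2 ->
  measurable_fun D1 g1 -> measurable_fun D2 g2 ->
  (forall x, 0 <= f x)%E ->
  (forall x, D1 x -> 0 <= g1 x)%E -> (forall x, D2 x -> 0 <= g2 x)%E ->
  (forall x, D1 x -> f x <= g1 x)%E -> (forall x, D2 x -> f x <= g2 x)%E ->
  (forall x, ~ D1 x -> ~ D2 x -> f x = 0%E) ->
  (\int[leb]_x f x <= \int[leb]_(x in D1) g1 x + \int[leb]_(x in D2) g2 x)%E.
Proof.
move=> mD1 mD2 mg1 mg2 f0 g10 g20 fg1 fg2 fD.
have h1 x : (0 <= (g1 \_ D1) x)%E by exact: erestrict_ge0.
have h2 x : (0 <= (g2 \_ D2) x)%E by exact: erestrict_ge0.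
rewrite [X in (_ <= X + _)%E]integral_mkcond [X in (_ <= _ + X)%E]integral_mkcond.
rewrite -ge0_integralD//; last 2 first.
- exact/(measurable_restrictT _ _).1.
- exact/(measurable_restrictT _ _).1.
apply: ge0_le_integral_setT => // x.
have [D1x|nD1] := pselect (D1 x).
  by rewrite {1}/patch mem_set//; apply: le_trans (fg1 x D1x) (leeDl _ (h2 x)).
have [D2x|nD2] := pselect (D2 x).
  by rewrite {2}/patch mem_set//; apply: le_trans (fg2 x D2x) (leeDr _ (h1 x)).
by rewrite fD// adde_ge0.
Qed.

(* [(d + x)^-1] dominates [(d + x)^(-(1 + e))], whose integral is of order [1 / e]. *)
Lemma integral_ge_harmonic (c d a : R) (f : R -> \bar R) :
  0 < c -> 1 <= d + a -> (forall x, 0 <= f x)%E ->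
  (forall x, (a <= x)%R -> (c * (d + x)^-1)%:E <= f x)%E ->
  (\int[leb]_x f x = +oo)%E.
Proof.
move=> c0 da f0 cf; apply/eqyP => M M0.
have da0 : 0 < d + a by lra.
pose c' := c * (d + a)^-1; have c'0 : 0 < c' by rewrite mulr_gt0 ?invr_gt0.
pose e := Num.min 1 (c' / M).
have e0 : 0 < e by rewrite lt_min ltr01 divr_gt0.
have e1 : e <= 1 by rewrite ge_min lexx.
have eM : M <= c' / e.
  by rewrite ler_pdivlMr// mulrC -ler_pdivlMr// ge_min lexx orbT.
apply: (@le_trans _ _ (\int[leb]_(x in `[a, +oo[) (c * (d + x) `^ (- (1 + e)))%:E)%E).
  rewrite integral_powR_tailZ ?(ltW c0)// lee_fin (le_trans eM)//.
  rewrite mulrA ler_pM2r ?invr_gt0// ler_pM2l//.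
  by rewrite -powR_inv1 ?(ltW da0)// ler_powR// lerN2.
apply: integral_ge_in => //.
  by move=> x _; rewrite lee_fin mulr_ge0 ?powR_ge0// ltW.
move=> x; rewrite /= in_itv/= andbT => ax; apply: le_trans (cf x ax).
rewrite lee_fin ler_pM2l// -powR_inv1; last by lra.
by rewrite ler_powR; lra.
Qed.

Lemma powRVl (a r : R) : 0 <= a -> a^-1 `^ r = (a `^ r)^-1.
Proof. by move=> a0; rewrite -powR_inv1// -powRrM mulN1r powRN. Qed.

Lemma expRN_le_powR (q x : R) : 0 < q -> 0 < x ->
  expR (- (x / 2)) <= (2 * q) `^ q * x `^ (- q).
Proof.
move=> q0 x0; have q2 : 0 < 2 * q by lra.
have -> : (2 * q) `^ q * x `^ (- q) = ((x / (2 * q)) `^ q)^-1.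
  rewrite [in RHS]powRM ?invr_ge0 ?(ltW x0) ?(ltW q2)//.
  by rewrite powRVl ?(ltW q2)// powRN invfM invrK mulrC.
rewrite expRN lef_pV2 ?posrE ?expR_gt0 ?powR_gt0 ?divr_gt0//.
rewrite (_ : x / 2 = x / (2 * q) * q); last by field; lra.
rewrite expRM ge0_ler_powR ?nnegrE ?expR_ge0 ?divr_ge0 ?ltW//.
by have := expR_ge1Dx (x / (2 * q)); lra.
Qed.

(* The integral is carried, up to constants, by [s] of order [Q]: the interval
   [[Q, 2 Q]] gives the lower bound, and the exponential factor tames [s < Q]. *)
Lemma integral_inv_gamma_bounds (h : R) : 0 < h ->
  exists kK : R * R, 0 < kK.1 /\ 0 < kK.2 /\ forall c Q, 0 <= c -> 0 < Q ->
  ((c * kK.1 * Q `^ (- h))%:E <=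
   \int[leb]_s (if (0 < s)%R then
      (c * (s `^ (- (1 + h)) * expR (- (Q / s / 2))))%:E else 0) /\
   \int[leb]_s (if (0 < s)%R then
      (c * (s `^ (- (1 + h)) * expR (- (Q / s / 2))))%:E else 0) <=
    (c * kK.2 * Q `^ (- h))%:E)%E.
Proof.
move=> h0; have q0 : 0 < 1 + h by lra.
pose k := 2 `^ (- (1 + h)) * expR (- 2^-1) : R.
pose K := (2 * (1 + h)) `^ (1 + h) + h^-1 : R.
exists (k, K); rewrite /=; split; first by rewrite mulr_gt0 ?powR_gt0 ?expR_gt0.
split; first by rewrite addr_gt0 ?invr_gt0// powR_gt0//; lra.
move=> c Q c0 Q0.
set f := (X in integral _ _ X).
have f0 s : (0 <= f s)%E.
  by rewrite /f; case: ifP => // _; rewrite lee_fin !mulr_ge0 ?powR_ge0 ?expR_ge0.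
have QE : Q `^ (- h) = Q * Q `^ (- (1 + h)).
  rewrite -[X in X * _](@powRr1 _ Q) ?(ltW Q0)// -powRD; last first.
    by apply/implyP => _; rewrite gt_eqF.
  by congr (_ `^ _); lra.
split.
  apply: le_trans (@integral_itv_ge Q (2 * Q) (c * (k * Q `^ (- (1 + h)))) f _ _ _ _) => //.
  - rewrite lee_fin QE le_eqVlt; apply/predU1P; left; ring.
  - lra.
  - by rewrite !mulr_ge0 ?powR_ge0 ?expR_ge0.
  - move=> s /andP[Qs sQ]; have s0 : 0 < s by lra.
    rewrite /f s0 lee_fin ler_wpM2l// /k mulrAC ler_pM ?mulr_ge0 ?powR_ge0 ?expR_ge0//.
      rewrite -powRM ?(ltW Q0)// !powRN lef_pV2 ?posrE ?powR_gt0//; last by lra.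
      by rewrite ge0_ler_powR ?nnegrE//; lra.
    rewrite ler_expR lerN2 -[leRHS]mul1r ler_pM2r ?invr_gt0//.
    by rewrite ler_pdivrMr// mul1r.
have le_split : (\int[leb]_s f s <=
    \int[leb]_(s in `[0%R, Q]) (c * ((2 * (1 + h)) `^ (1 + h) * Q `^ (- (1 + h))))%:E +
    \int[leb]_(s in `[Q, +oo[) (c * (0 + s) `^ (- (1 + h)))%:E)%E.
  apply: integral_le_split => //.
  - by apply/measurable_EFinP/measurable_funM => //; exact: measurable_powRDl.
  - by move=> s _; rewrite lee_fin !mulr_ge0 ?powR_ge0.
  - by move=> s _; rewrite lee_fin !mulr_ge0 ?powR_ge0.
  - move=> s; rewrite /= in_itv/= => /andP[_ sQ]; rewrite /f; case: ifPn => [s0|_]; last first.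
      by rewrite lee_fin !mulr_ge0 ?powR_ge0.
    rewrite lee_fin ler_wpM2l//.
    have sq0 := powR_gt0 (- (1 + h)) s0.
    apply: (@le_trans _ _ (s `^ (- (1 + h)) *
        ((2 * (1 + h)) `^ (1 + h) * (Q / s) `^ (- (1 + h))))).
      by rewrite ler_pM2l// expRN_le_powR// divr_gt0.
    rewrite le_eqVlt; apply/predU1P; left.
    rewrite [(Q / s) `^ _]powRM ?(ltW Q0) ?invr_ge0 ?(ltW s0)// powRVl ?(ltW s0)//.
    rewrite !powRN; have := powR_gt0 (1 + h) s0 => sp.
    by field; rewrite !gt_eqF// powR_gt0.
  - move=> s; rewrite /= in_itv/= andbT => Qs.
    have s0 : 0 < s by lra.
    rewrite /f s0 add0r lee_fin ler_wpM2l// ler_piMr ?powR_ge0//.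
    by rewrite -expR0 ler_expR oppr_le0 !divr_ge0 ?ltW.
  - move=> s /=; rewrite !in_itv/= andbT => /negP h1 /negP h2.
    by rewrite /f; case: ifPn => // s0; move: h1 h2; rewrite (ltW s0)/=; case: leP => //= /ltW ->.
apply: (le_trans le_split).
rewrite integral_powR_tailZ// ?add0r// integral_cst//= lebesgue_measure_itv/= lte_fin Q0.
rewrite -EFinB -EFinM -EFinD lee_fin QE /K subr0.
rewrite le_eqVlt; apply/predU1P; left; ring.
Qed.

End Integrals.

Section LinearAlgebra.
Variable R : realType.

Definition dot (n : nat) (u v : 'cV[R]_n) : R := \sum_(i < n) u i 0 * v i 0.
Definition sqn (n : nat) (u : 'cV[R]_n) : R := dot u u.

Lemma dotE n (u v : 'cV[R]_n) : dot u v = (u^T *m v) 0 0.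
Proof. by rewrite mxE; apply: eq_bigr => i _; rewrite mxE. Qed.

Lemma enorm_sqr n (u : 'cV[R]_n) : enorm u ^+ 2 = sqn u.
Proof. by rewrite sqr_sqrtr// sumr_ge0// => i _; exact: sqr_ge0. Qed.

Lemma dotC n (u v : 'cV[R]_n) : dot u v = dot v u.
Proof. by apply: eq_bigr => i _; rewrite mulrC. Qed.

Lemma dotDl n (u v w : 'cV[R]_n) : dot (u + v) w = dot u w + dot v w.
Proof. by rewrite -big_split; apply: eq_bigr => i _; rewrite mxE mulrDl. Qed.

Lemma dotZl n a (u v : 'cV[R]_n) : dot (a *: u) v = a * dot u v.
Proof. by rewrite mulr_sumr; apply: eq_bigr => i _; rewrite mxE mulrA. Qed.

Lemma dotDr n (u v w : 'cV[R]_n) : dot w (u + v) = dot w u + dot w v.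
Proof. by rewrite !(dotC w) dotDl. Qed.

Lemma dotZr n a (u v : 'cV[R]_n) : dot u (a *: v) = a * dot u v.
Proof. by rewrite !(dotC u) dotZl. Qed.

Lemma dotNl n (u v : 'cV[R]_n) : dot (- u) v = - dot u v.
Proof. by rewrite -scaleN1r dotZl mulN1r. Qed.

Lemma dotNr n (u v : 'cV[R]_n) : dot u (- v) = - dot u v.
Proof. by rewrite !(dotC u) dotNl. Qed.

Definition dotlin := (dotDl, dotDr, dotNl, dotNr, dotZl, dotZr).

Lemma dot_mull n p (X : 'M[R]_(n, p)) b (v : 'cV[R]_n) :
  dot (X *m b) v = dot b (X^T *m v).
Proof. by rewrite !dotE trmx_mul -mulmxA. Qed.

Lemma dot0r n (u : 'cV[R]_n) : dot u 0 = 0.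
Proof. by rewrite -(scale0r 0) dotZr mul0r. Qed.

Lemma dot0l n (u : 'cV[R]_n) : dot 0 u = 0.
Proof. by rewrite dotC dot0r. Qed.

Lemma sqn_ge0 n (u : 'cV[R]_n) : 0 <= sqn u.
Proof. by apply: sumr_ge0 => i _; rewrite -expr2 sqr_ge0. Qed.

Lemma sqn_eq0 n (u : 'cV[R]_n) : sqn u = 0 -> u = 0.
Proof.
move=> /eqP; rewrite psumr_eq0 => [/allP u0|i _]; last by rewrite -expr2 sqr_ge0.
apply/matrixP => i j; rewrite (ord1 j) mxE; apply/eqP.
by have := u0 i (mem_index_enum _); rewrite -expr2 sqrf_eq0.
Qed.

Lemma sqn_gt0 n (u : 'cV[R]_n) : u != 0 -> 0 < sqn u.
Proof.
by move=> u0; rewrite lt_def sqn_ge0 andbT; apply: contra_neq u0; exact: sqn_eq0.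
Qed.

Lemma sqn_ortho n (u v : 'cV[R]_n) : dot u v = 0 -> sqn (u + v) = sqn u + sqn v.
Proof. by move=> uv; rewrite /sqn !dotlin (dotC v) uv addr0 add0r. Qed.

Definition full_rank n p (X : 'M[R]_(n, p)) := forall v : 'cV[R]_p, X *m v = 0 -> v = 0.

Lemma full_rankP n p (X : 'M[R]_(n, p)) : \rank X = p -> full_rank X.
Proof.
move=> rX v Xv; have fr : row_free X^T by rewrite /row_free mxrank_tr rX.
apply: trmx_inj; apply: (row_free_inj fr).
by rewrite -trmx_mul Xv !trmx0 mul0mx.
Qed.

Lemma gram_unit n p (X : 'M[R]_(n, p)) : full_rank X -> X^T *m X \in unitmx.
Proof.
move=> fX; rewrite -row_free_unit; apply: inj_row_free => v vG.
have : sqn (X *m v^T) = 0.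
  rewrite /sqn dot_mull (_ : X^T *m _ = 0) ?dot0r//.
  by apply: trmx_inj; rewrite trmx0 !trmx_mul !trmxK -mulmxA.
by move=> /sqn_eq0 /fX /(congr1 trmx); rewrite trmxK trmx0.
Qed.

Lemma proj_exists n p (X : 'M[R]_(n, p)) (y : 'cV[R]_n) : full_rank X ->
  exists h r, y = X *m h + r /\ X^T *m r = 0.
Proof.
move=> /gram_unit Gu; pose h := invmx (X^T *m X) *m (X^T *m y).
exists h, (y - X *m h); split; first by rewrite addrC subrK.
by rewrite mulmxBr mulmxA /h mulmxA mulmxV// mul1mx subrr.
Qed.

Lemma full_rank_split n p (X : 'M[R]_(n, 1 + p)) : full_rank X ->
  let X' := rsubmx X in
  full_rank X' /\ exists (w : 'cV[R]_p) (r : 'cV[R]_n),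
    [/\ X = row_mx (X' *m w + r) X', X'^T *m r = 0 & r != 0].
Proof.
move=> fX X'; have EX : X = row_mx (lsubmx X) X' by rewrite hsubmxK.
have fX' : full_rank X'.
  move=> v X'v; have := fX (col_mx 0 v).
  rewrite EX mul_row_col mulmx0 add0r => /(_ X'v) /eqP.
  by rewrite col_mx_eq0 => /andP[_ /eqP].
split=> //; have [w [r [Ex rX']]] := proj_exists (lsubmx X) fX'.
exists w, r; split=> //; first by rewrite -Ex.
apply/eqP => r0; have := fX (col_mx 1 (- w)).
rewrite EX mul_row_col mulmx1 mulmxN Ex r0 addr0 subrr => /(_ erefl) /eqP.
rewrite col_mx_eq0 => /andP[/eqP /matrixP /(_ 0 0)].
by rewrite !mxE eqxx => /eqP; rewrite oner_eq0.
Qed.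

Lemma gram_det_gt0 n p (X : 'M[R]_(n, p)) : full_rank X -> 0 < \det (X^T *m X).
Proof.
elim: p X => [|p IH] X fX; first by rewrite det_mx00.
have [fX' [w [r [EX rX' r0]]]] := @full_rank_split n p X fX.
set X' := rsubmx _ in fX' EX rX'.
pose U : 'M[R]_(1 + p) := block_mx 1 0 w 1.
have EX2 : X = row_mx r X' *m U.
  by rewrite mul_row_block !mulmx1 mulmx0 add0r [in LHS]EX addrC.
have -> : \det (X^T *m X) = \det (U^T *m (block_mx (r^T *m r) 0 0 (X'^T *m X')) *m U).
  have <- : (row_mx r X')^T *m row_mx r X' = block_mx (r^T *m r) 0 0 (X'^T *m X').
    rewrite tr_row_mx mul_col_row rX'; congr (block_mx _ _ _ _).
    by apply: trmx_inj; rewrite trmx_mul trmxK rX' trmx0.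
  by rewrite {1 2}EX2 trmx_mul -!mulmxA.
rewrite !det_mulmx det_tr !(@det_lblock _ 1) !det1 !mul1r mulr1 det_mx11 -dotE mulr_gt0 ?IH//.
exact: sqn_gt0.
Qed.

Lemma int_cV_gauss n p (X : 'M[R]_(n, p)) : full_rank X -> exists K : R, 0 < K /\
  forall c a (m : 'cV[R]_p), 0 <= c -> 0 < a ->
  int_cV (fun b => (c * expR (- (a * sqn (X *m (b - m)))))%:E) =
  (c * K * a `^ (- (p%:R / 2)))%:E.
Proof.
elim: p X => [|p IH] X fX.
  exists 1; split=> // c a m c0 a0 /=.
  rewrite (flatmx0 (0 - m)) mulmx0 /sqn dot0l mulr0 oppr0 expR0.
  by rewrite mul0r oppr0 powRr0 !mulr1.
have [fX' [w [r [EX rX' r0]]]] := @full_rank_split n p X fX.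
set X' := rsubmx _ in fX' EX rX'.
have [K [K0 HK]] := IH _ fX'.
have s0 := sqn_gt0 r0.
exists (K * Num.sqrt (pi / sqn r)); split.
  by rewrite mulr_gt0// sqrtr_gt0 divr_gt0// pi_gt0.
move=> c a m c0 a0 /=.
pose mx := m 0 0; pose mv : 'cV[R]_p := dsubmx (m : 'cV[R]_(1 + p)).
have Em : m = col_mx (\col_(i < 1) mx) mv :> 'cV[R]_(1 + p).
  transitivity (col_mx (usubmx (m : 'cV[R]_(1 + p))) mv); first by rewrite vsubmxK.
  congr col_mx; apply/matrixP => i j.
  by rewrite !mxE !ord1 /mx; congr (m _ _); exact: val_inj.
have subE x (v : 'cV[R]_p) : (col_mx (\col_(i < 1) x) v : 'cV[R]_(1 + p)) - m =
    col_mx (x - mx)%:M (v - mv) :> 'cV[R]_(1 + p).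
  rewrite [in LHS]Em (@opp_col_mx _ 1 p) (@add_col_mx _ 1 p); congr col_mx.
  by apply/matrixP => i j; rewrite !mxE !ord1 eqxx mulr1n.
have key x (v : 'cV[R]_p) :
    sqn (X *m ((col_mx (\col_(i < 1) x) v : 'cV[R]_p.+1) - m)) =
    sqn r * (x - mx) ^+ 2 + sqn (X' *m (v - (mv - (x - mx) *: w))).
  rewrite -[sqn r * _]mulrC expr2 -mulrA -dotZr -dotZl -sqn_ortho; last first.
    by rewrite dotZl dotC dot_mull rX' dot0r mulr0.
  rewrite [_ - m]subE EX (@mul_row_col _ n 1 p 1) mul_mx_scalar; congr sqn.
  rewrite opprB [v + (_ - _)]addrCA scalerDr [X' *m (_ *: w + _)]mulmxDr -scalemxAr addrA.
  by congr (_ + _); rewrite addrC.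
transitivity (\int[@lebesgue_measure R]_x
    ((c * K * a `^ (- (p%:R / 2))) * expR (- (a * sqn r * (x - mx) ^+ 2)))%:E)%E.
  apply: eq_integral => x _.
  under [X in int_cV X]eq_fun => v.
    rewrite key mulrDr opprD expRD mulrA.
    over.
  rewrite HK//; last by rewrite mulr_ge0 ?expR_ge0.
  by congr EFin; rewrite mulrA; ring.
rewrite integral_gauss ?mulr_ge0 ?mulr_gt0 ?powR_ge0// ?(ltW K0)//.
congr EFin; rewrite -!mulrA; congr (_ * (_ * _)).
have -> : pi / (a * sqn r) = (pi / sqn r) * a^-1 by field; rewrite !gt_eqF.
rewrite sqrtrM; last by rewrite divr_ge0 ?pi_ge0// ltW.
rewrite mulrCA; congr (_ * _).
rewrite -powR12_sqrt ?invr_ge0 ?(ltW a0)// powRVl ?(ltW a0)// -powRN -powRD; last first.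
  by apply/implyP => _; rewrite gt_eqF.
congr (_ `^ _); rewrite -natr1; lra.
Qed.

End LinearAlgebra.

Section Marginal.
Variable R : realType.
Local Notation leb := (@lebesgue_measure R).

Lemma int_cV0 p : int_cV (fun _ : 'cV[R]_p => 0%E) = 0%E.
Proof. by elim: p => //= p ->; exact: integral0. Qed.

Lemma sqn_split n p (X : 'M[R]_(n, p)) (al mu g : R) (b be : 'cV[R]_p) (r : 'cV[R]_n) :
  (const_mx 1 : 'rV[R]_n) *m X = 0 -> (const_mx 1 : 'rV[R]_n) *m r = 0 ->
  X^T *m r = 0 -> 0 < g ->
  sqn (mu *: const_mx 1 + X *m b + r - al *: const_mx 1 - X *m be) +
    g^-1 * sqn (X *m be) =
  n%:R * (al - mu) ^+ 2 + (sqn r + sqn (X *m b) / (1 + g)) +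
  (1 + g) / g * sqn (X *m (be - (g / (1 + g)) *: b)).
Proof.
move=> oX or Xr g0; set o : 'cV[R]_n := const_mx 1.
have oT : o = (const_mx 1 : 'rV[R]_n)^T by rewrite trmx_const.
have oX0 v : dot o (X *m v) = 0.
  by rewrite dotE oT trmxK mulmxA oX mul0mx mxE.
have or0 : dot o r = 0 by rewrite dotE oT trmxK or mxE.
have Xr0 v : dot (X *m v) r = 0 by rewrite dot_mull Xr dot0r.
have oo : dot o o = n%:R.
  rewrite /dot (eq_bigr (fun _ => 1)) => [|i _]; last by rewrite !mxE mulr1.
  by rewrite sumr_const card_ord.
rewrite /sqn mulmxBr -scalemxAr !dotlin !(dotC r) !(dotC _ o) !oX0 !or0 !Xr0 oo.
rewrite (dotC (X *m be) (X *m b)).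
have g1 : 1 + g != 0 by rewrite gt_eqF// addr_gt0.
by field; rewrite g1 gt_eqF.
Qed.

Lemma integrandE n p (X : 'M[R]_(n, p)) (P al mu g s : R) (b be : 'cV[R]_p) (r : 'cV[R]_n) :
  full_rank X ->
  (const_mx 1 : 'rV[R]_n) *m X = 0 -> (const_mx 1 : 'rV[R]_n) *m r = 0 ->
  X^T *m r = 0 -> 0 < g -> 0 < s ->
  P * lik X (mu *: const_mx 1 + X *m b + r) al be s * beta_prior X g s be =
  P * (2 * pi * s) `^ (- (n%:R / 2)) *
    ((2 * pi) `^ (- (p%:R / 2)) *
     ((g * s) ^+ p * (\det (X^T *m X))^-1) `^ (- (1 / 2))) *
    expR (- ((sqn r + sqn (X *m b) / (1 + g)) / s / 2)) *
    expR (- (n%:R / (2 * s) * (al - mu) ^+ 2)) *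
    expR (- ((1 + g) / g / (2 * s) * sqn (X *m (be - (g / (1 + g)) *: b)))).
Proof.
move=> fX oX or Xr g0 s0; have Gu := gram_unit fX.
have gs0 : g * s != 0 by rewrite gt_eqF// mulr_gt0.
have G0 : \det (X^T *m X) != 0 by rewrite gt_eqF// gram_det_gt0.
rewrite /lik /beta_prior enorm_sqr.
have -> : invmx ((g * s) *: invmx (X^T *m X)) = (g * s)^-1 *: (X^T *m X).
  by rewrite invmxZ ?invmxK// unitmxZ ?unitmx_inv ?unitfE.
have -> : (be^T *m ((g * s)^-1 *: (X^T *m X)) *m be) 0 0 = (g * s)^-1 * sqn (X *m be).
  by rewrite -scalemxAr -scalemxAl mxE /sqn dotE trmx_mul !mulmxA.
rewrite detZ det_inv.
have E := sqn_split al mu b be oX or Xr g0.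
have -> : forall a c d e f : R, P * (a * c) * (d * e * f) = P * a * (d * e) * (c * f).
  by move=> *; ring.
rewrite -!mulrA; congr (P * (_ * (_ * (_ * _)))).
rewrite -!expRD; congr expR.
have -> : sqn (mu *: const_mx 1 + X *m b + r - al *: const_mx 1 - X *m be) =
  n%:R * (al - mu) ^+ 2 + (sqn r + sqn (X *m b) / (1 + g)) +
  (1 + g) / g * sqn (X *m (be - (g / (1 + g)) *: b)) - g^-1 * sqn (X *m be).
  by rewrite -E addrK.
have g1 : 1 + g != 0 by rewrite gt_eqF// addr_gt0.
by field; rewrite g1 !gt_eqF.
Qed.

Lemma integrand_const (n p : nat) (P K D g s : R) : (0 < n)%N -> 0 < K -> 0 < D ->
  0 < g -> 0 < s ->
  P * s^-1 * (2 * pi * s) `^ (- (n%:R / 2)) *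
    ((2 * pi) `^ (- (p%:R / 2)) * ((g * s) ^+ p * D) `^ (- (1 / 2))) *
  K * ((1 + g) / g / (2 * s)) `^ (- (p%:R / 2)) * Num.sqrt (pi / (n%:R / (2 * s))) =
  P * ((2 * pi) `^ (- (n%:R / 2)) * (2 * pi) `^ (- (p%:R / 2)) * D `^ (- (1 / 2)) * K *
       (2 `^ (- (p%:R / 2)))^-1 * Num.sqrt (2 * pi / n%:R)) *
  (1 + g) `^ (- (p%:R / 2)) * s `^ (- (1 + (n%:R - 1) / 2)).
Proof.
move=> n0 K0 D0 g0 s0; have pi0 := pi_gt0 R.
have n0' : 0 < n%:R :> R by rewrite ltr0n.
have -> : pi / (n%:R / (2 * s)) = 2 * pi / n%:R * s by field; lra.
rewrite sqrtrM; last by rewrite divr_ge0// mulr_ge0// ltW.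
rewrite -(powR12_sqrt (ltW s0)).
have -> : s `^ (- (1 + (n%:R - 1) / 2)) = s^-1 * s `^ (- (n%:R / 2)) * s `^ 2^-1.
  rewrite -(powR_inv1 (ltW s0)) -!powRD; first by congr (_ `^ _); lra.
    by apply/implyP => _; rewrite gt_eqF.
  by apply/implyP => _; rewrite gt_eqF.
rewrite [(2 * pi * s) `^ _]powRM ?mulr_ge0 ?(ltW pi0) ?(ltW s0)//.
rewrite [(_ * D) `^ _]powRM ?exprn_ge0 ?mulr_ge0 ?(ltW g0) ?(ltW s0) ?(ltW D0)//.
rewrite -[(g * s) ^+ p]powR_mulrn ?mulr_ge0 ?(ltW g0) ?(ltW s0)// -powRrM.
have -> : p%:R * - (1 / 2) = - (p%:R / 2) :> R by lra.
set e := - (p%:R / 2).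
rewrite [(g * s) `^ e]powRM ?(ltW g0) ?(ltW s0)//.
have g1 : 0 <= 1 + g by lra.
have s2 : 0 <= (2 * s)^-1 by rewrite invr_ge0; lra.
rewrite [(_ / (2 * s)) `^ e]powRM ?divr_ge0 ?(ltW g0)//.
rewrite [((1 + g) / g) `^ e]powRM ?invr_ge0 ?(ltW g0)//.
rewrite [(2 * s)^-1 `^ e]powRVl ?mulr_ge0 ?(ltW s0)// [g^-1 `^ e]powRVl ?(ltW g0)//.
rewrite [(2 * s) `^ e]powRM ?(ltW s0)//.
have ge0 := powR_gt0 e g0; have se0 := powR_gt0 e s0.
have te0 : 0 < 2 `^ e :> R by rewrite powR_gt0.
field; rewrite !gt_eqF//.
Qed.

Definition phi (n p : nat) (S T k g : R) : \bar R :=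
  if (p.+1%:R)^-1 * (1 + n%:R) - 1 < g then
    (k * ((1 + g) `^ (- ((p%:R + 3) / 2)) *
          (S + T / (1 + g)) `^ (- ((n%:R - 1) / 2))))%:E
  else 0%E.

(* Integrating out [beta], then [alpha], leaves an inverse gamma integral in
   [sigma^2], whose size is the power of the quadratic form appearing in [phi]. *)
Lemma marg_lik_bounds n p (X : 'M[R]_(n, p)) : full_rank X ->
  (const_mx 1 : 'rV[R]_n) *m X = 0 -> (p < n)%N -> (1 < n)%N ->
  exists kK : R * R, [/\ 0 < kK.1, 0 < kK.2 & forall mu (b : 'cV[R]_p) (r : 'cV[R]_n),
    (const_mx 1 : 'rV[R]_n) *m r = 0 -> X^T *m r = 0 -> 0 < sqn r + sqn (X *m b) ->
    (\int[leb]_g phi n p (sqn r) (sqn (X *m b)) kK.1 g <=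
       marg_lik X (mu *: const_mx 1 + X *m b + r)%R /\
     marg_lik X (mu *: const_mx 1 + X *m b + r)%R <=
       \int[leb]_g phi n p (sqn r) (sqn (X *m b)) kK.2 g)%E].
Proof.
move=> fX oX pn n1; have n0 : (0 < n)%N by exact: ltnW.
have n0' : 0 < n%:R :> R by rewrite ltr0n.
have D0 : 0 < (\det (X^T *m X))^-1 by rewrite invr_gt0 gram_det_gt0.
have [K [K0 HK]] := int_cV_gauss fX.
pose h : R := (n%:R - 1) / 2.
have h0 : 0 < h by rewrite divr_gt0// subr_gt0 ltr1n.
have [[k1 k2] /= [k10 [k20 Hk]]] := integral_inv_gamma_bounds h0.
pose B : R := (p.+1%:R)^-1 * (1 + n%:R).
have B1 : 1 < B.
  by rewrite /B mulrC ltr_pdivlMr ?ltr0n// mul1r addrC natr1 ltr_nat ltnS.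
pose A : R := (2 * pi) `^ (- (n%:R / 2)) * (2 * pi) `^ (- (p%:R / 2)) *
  ((\det (X^T *m X))^-1) `^ (- (1 / 2)) * K *
  (2 `^ (- (p%:R / 2)))^-1 * Num.sqrt (2 * pi / n%:R).
have A0 : 0 < A.
  have pi0 := pi_gt0 R; have pi20 : 0 < 2 * pi :> R by rewrite mulr_gt0.
  by rewrite /A !mulr_gt0 ?invr_gt0 ?sqrtr_gt0 ?powR_gt0 ?divr_gt0.
pose C := 1 / 2 * B `^ (1 / 2) * A.
have C0 : 0 < C.
  have B0 : 0 < B by exact: lt_trans B1.
  by rewrite /C mulr_gt0// mulr_gt0 ?divr_gt0 ?powR_gt0.
exists (C * k1, C * k2); split; [exact: mulr_gt0|exact: mulr_gt0|move=> mu b r or Xr Q0 /=].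
set y := mu *: const_mx 1 + X *m b + r.
set S := sqn r in Q0 *; set T := sqn (X *m b) in Q0 *.
have inner g : B - 1 < g ->
  (\int[leb]_s2 \int[leb]_alpha int_cV (fun beta : 'cV[R]_p =>
     (robust_g_prior (1/2) 1 (p.+1%:R)^-1 n g * (if 0 < s2 then s2^-1 else 0) *
      lik X y alpha beta s2 * beta_prior X g s2 beta)%:E) =
  \int[leb]_s (if (0 < s)%R then
      (C * (1 + g) `^ (- ((p%:R + 3) / 2)) *
       (s `^ (- (1 + h)) * expR (- ((S + T / (1 + g)) / s / 2))))%:E else 0))%E.
  move=> Bg; have g0 : 0 < g by clear -Bg B1; lra.
  apply: eq_integral => s _; case: ifPn => [s0|_]; last first.
    rewrite (_ : (fun _ => _) = (fun _ => 0%E)); first exact: integral0.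
    apply/funext => al; rewrite (_ : (fun _ => _) = (fun _ => 0%E)) ?int_cV0//.
    by apply/funext => be; rewrite mulr0 !mul0r.
  set P := robust_g_prior _ _ _ _ _.
  have P0 : 0 <= P.
    rewrite /P /robust_g_prior; case: ifP => // _.
    by rewrite !mulr_ge0 ?powR_ge0.
  pose a := (1 + g) / g / (2 * s).
  have a0 : 0 < a by rewrite !divr_gt0 ?mulr_gt0//; clear -g0; lra.
  pose c := P * s^-1 * (2 * pi * s) `^ (- (n%:R / 2)) *
    ((2 * pi) `^ (- (p%:R / 2)) *
     ((g * s) ^+ p * (\det (X^T *m X))^-1) `^ (- (1 / 2))).
  have c0 : 0 <= c by rewrite !mulr_ge0 ?invr_ge0 ?powR_ge0 ?(ltW s0).
  pose E := expR (- ((S + T / (1 + g)) / s / 2)).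
  transitivity (\int[leb]_al (c * E * K * a `^ (- (p%:R / 2)) *
      expR (- (n%:R / (2 * s) * (al - mu) ^+ 2)))%:E)%E.
    apply: eq_integral => al _.
    rewrite (_ : (fun _ => _) = (fun be => (c * E * expR (- (n%:R / (2 * s) * (al - mu) ^+ 2)) *
      expR (- (a * sqn (X *m (be - (g / (1 + g)) *: b)))))%:E)); last first.
      by apply/funext => be; rewrite integrandE.
    rewrite HK//; first by congr EFin; ring.
    by rewrite mulr_ge0 ?expR_ge0// mulr_ge0 ?expR_ge0.
  rewrite integral_gauss; last 2 first.
  - rewrite mulr_ge0 ?powR_ge0// mulr_ge0 ?(ltW K0)//.
    by rewrite mulr_ge0 ?expR_ge0.
  - by rewrite divr_gt0 ?mulr_gt0.
  congr EFin.
  have := @integrand_const n p P K _ g s n0 K0 D0 g0 s0; rewrite -/c -/a -/A => HC.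
  have -> : c * E * K * a `^ (- (p%:R / 2)) * Num.sqrt (pi / (n%:R / (2 * s))) =
     c * K * a `^ (- (p%:R / 2)) * Num.sqrt (pi / (n%:R / (2 * s))) * E by ring.
  rewrite HC /P /robust_g_prior -/B Bg.
  have -> : - ((p%:R + 3) / 2) = - (1 / 2 + 1) + - (p%:R / 2) :> R by clear; lra.
  rewrite powRD; last by apply/implyP => _; rewrite gt_eqF//; clear -g0; lra.
  by rewrite [g + 1]addrC /C /E /h; ring.
have Qg0 g : B - 1 < g -> 0 < S + T / (1 + g).
  move=> Bg; have g0 : 0 < 1 + g by clear -Bg B1; lra.
  have [S0|/eqP S0] := boolP (S == 0).
    by rewrite (eqP S0) add0r divr_gt0//; move: Q0; rewrite (eqP S0) add0r.
  apply: ltr_wpDr; first by rewrite divr_ge0 ?sqn_ge0// ltW.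
  by rewrite lt_def sqn_ge0 andbT; apply/eqP.
have c0 g : 0 <= C * (1 + g) `^ (- ((p%:R + 3) / 2)) by rewrite mulr_ge0 ?powR_ge0// ltW.
have phi0 k g : 0 < k -> (0 <= phi n p S T (C * k) g)%E.
  move=> k0; rewrite /phi; case: ifP => // _.
  by rewrite lee_fin mulr_ge0 ?(ltW (mulr_gt0 C0 k0))// mulr_ge0 ?powR_ge0.
set f := fun g : R => (\int[leb]_s2 \int[leb]_alpha int_cV (fun beta : 'cV[R]_p =>
     (robust_g_prior (1/2) 1 (p.+1%:R)^-1 n g * (if 0 < s2 then s2^-1 else 0) *
      lik X y alpha beta s2 * beta_prior X g s2 beta)%:E))%E.
have f_bounds g : (phi n p S T (C * k1) g <= f g <= phi n p S T (C * k2) g)%E.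
  rewrite /phi -/B; case: ifPn => [Bg|/negbTE nBg].
    have [lo up] := Hk _ _ (c0 g) (Qg0 _ Bg).
    rewrite /f inner//; apply/andP; split.
      by apply: le_trans lo; rewrite lee_fin le_eqVlt; apply/predU1P; left; ring.
    by apply: (le_trans up); rewrite lee_fin le_eqVlt; apply/predU1P; left; ring.
  rewrite /f (_ : (fun _ => _) = (fun _ => 0%E)); first by rewrite integral0 lexx.
  apply/funext => s; rewrite (_ : (fun _ => _) = (fun _ => 0%E)); first exact: integral0.
  apply/funext => al; rewrite (_ : (fun _ => _) = (fun _ => 0%E)) ?int_cV0//.
  by apply/funext => be; rewrite /robust_g_prior -/B nBg !mul0r.
split; apply: ge0_le_integral_setT => g.
- exact: phi0.
- by have /andP[] := f_bounds g.
- by have /andP[+ _] := f_bounds g; apply: le_trans; exact: phi0.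
- by have /andP[] := f_bounds g.
Qed.

End Marginal.

Section Phi.
Variable R : realType.
Local Notation leb := (@lebesgue_measure R).

Lemma phi_ge0 n p (S T k g : R) : 0 <= k -> (0 <= phi n p S T k g)%E.
Proof.
by move=> k0; rewrite /phi; case: ifP => // _; rewrite lee_fin !mulr_ge0 ?powR_ge0.
Qed.

Lemma integral_phi_infty n p (T k : R) : (p + 2 <= n)%N -> 0 < T -> 0 < k ->
  (\int[leb]_g phi n p 0%R T k g = +oo)%E.
Proof.
move=> pn T0 k0; pose B : R := (p.+1%:R)^-1 * (1 + n%:R).
have B0 : 0 < B by rewrite mulr_gt0 ?invr_gt0 ?ltr0n// addrC natr1 ltr0n.
pose h : R := (n%:R - 1) / 2.
apply: (@integral_ge_harmonic R (k * T `^ (- h)) 1 B).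
- by rewrite mulr_gt0// powR_gt0.
- by rewrite lerDl ltW.
- by move=> g; apply: phi_ge0; rewrite ltW.
move=> g Bg; have g1 : 1 <= 1 + g by lra.
have g0 : 0 < 1 + g by lra.
rewrite /phi -/B -/h ifT; last by lra.
rewrite lee_fin add0r powRM ?invr_ge0 ?(ltW T0) ?(ltW g0)// powRVl ?(ltW g0)//.
rewrite -(powRN (1 + g)) opprK.
rewrite [leRHS](_ : _ = k * T `^ (- h) *
  ((1 + g) `^ (- ((p%:R + 3) / 2)) * (1 + g) `^ h)); last by ring.
rewrite ler_pM2l ?mulr_gt0 ?powR_gt0// -powRD; last first.
  by apply/implyP => _; rewrite gt_eqF.
rewrite -powR_inv1 ?(ltW g0)// ler_powR// /h.
have : (p + 2)%:R <= n%:R :> R by rewrite ler_nat.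
by rewrite natrD; lra.
Qed.

Lemma integral_phi_ge n p (S k : R) : (0 < n)%N -> 0 < S -> 0 < k ->
  exists c : R, 0 < c /\ forall T M, 0 <= T -> T <= M -> 1 <= M ->
    (p.+1%:R)^-1 * (1 + n%:R) <= M ->
    ((c * M `^ (- ((p%:R + 1) / 2)))%:E <= \int[leb]_g phi n p S T k g)%E.
Proof.
move=> n0 S0 k0; set B : R := (p.+1%:R)^-1 * (1 + n%:R).
pose h : R := (n%:R - 1) / 2; pose q : R := (p%:R + 3) / 2.
have h0 : 0 <= h by rewrite divr_ge0// subr_ge0 ler1n.
have q0 : 0 <= q by rewrite divr_ge0// addr_ge0.
pose c := k * (3 `^ (- q) * (S + 1) `^ (- h)).
exists c; split; first by rewrite /c !mulr_gt0 ?powR_gt0//; lra.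
move=> T M T0 TM M1 BM; have M0 : 0 < M by lra.
have -> : c * M `^ (- ((p%:R + 1) / 2)) = (c * M `^ (- q)) * (2 * M - M).
  have -> : 2 * M - M = M `^ 1 by rewrite powRr1 ?(ltW M0)//; ring.
  rewrite -mulrA -powRD; last by apply/implyP => _; rewrite gt_eqF.
  by congr (_ * _ `^ _); rewrite /q; lra.
apply: integral_itv_ge.
- by lra.
- by rewrite mulr_ge0 ?powR_ge0// /c ltW// !mulr_gt0 ?powR_gt0//; lra.
- by move=> g; apply: phi_ge0; rewrite ltW.
move=> g /andP[Mg gM]; rewrite /phi -/B -/h -/q ifT; last by lra.
have g0 : 0 < 1 + g by lra.
have Tg0 : 0 <= T / (1 + g) by rewrite divr_ge0// ltW.
have Tg : T / (1 + g) <= 1 by rewrite ler_pdivrMr// mul1r; lra.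
have -> : c * M `^ (- q) = k * ((3 * M) `^ (- q) * (S + 1) `^ (- h)).
  by rewrite powRM ?(ltW M0)// /c; ring.
rewrite lee_fin ler_pM2l// !powRN ler_pM ?invr_ge0 ?powR_ge0//.
  rewrite lef_pV2 ?posrE ?powR_gt0//; last by lra.
  by rewrite ge0_ler_powR ?nnegrE//; lra.
rewrite lef_pV2 ?posrE ?powR_gt0//; [|lra|lra].
by rewrite ge0_ler_powR ?nnegrE//; lra.
Qed.

Lemma integral_phi_le n p (S T k a b : R) : (p < n)%N -> 0 <= k -> 0 <= S -> 0 < T ->
  0 <= a -> 0 <= b -> a + b = (n%:R - 1) / 2 -> b + 5 / 4 <= (p%:R + 3) / 2 ->
  0 < S \/ a = 0 ->
  (\int[leb]_g phi n p S T k g <= (4 * k * S `^ (- a) * T `^ (- b))%:E)%E.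
Proof.
move=> pn k0 S0 T0 a0 b0 ab bq Sa; set B : R := (p.+1%:R)^-1 * (1 + n%:R).
have B1 : 1 < B.
  by rewrite /B mulrC ltr_pdivlMr ?ltr0n// mul1r addrC natr1 ltr_nat ltnS.
pose h : R := (n%:R - 1) / 2; pose q : R := (p%:R + 3) / 2.
pose c := k * S `^ (- a) * T `^ (- b).
have c0 : 0 <= c by rewrite !mulr_ge0 ?powR_ge0.
apply: (@le_trans _ _ (\int[leb]_(g in `[(B - 1)%R, +oo[) (c * (1 + g) `^ (- (1 + 1 / 4)))%:E)%E).
  apply: integral_le_in.
  - by move=> g; exact: phi_ge0.
  - move=> g; rewrite /= in_itv/= andbT => Bg; rewrite /phi -/B -/h -/q.
    have g0 : 0 < 1 + g by lra.
    case: ifPn => _; last by rewrite lee_fin mulr_ge0 ?powR_ge0.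
    have Tg0 : 0 < T / (1 + g) by rewrite divr_gt0.
    have ST0 : 0 < S + T / (1 + g) by lra.
    have Sa0 : 0 < S `^ a.
      by case: Sa => [|->]; [exact: powR_gt0|rewrite powRr0].
    have le1 : (S + T / (1 + g)) `^ (- h) <= S `^ (- a) * (T `^ (- b) * (1 + g) `^ b).
      have -> : S `^ (- a) * (T `^ (- b) * (1 + g) `^ b) =
                (S `^ a * (T / (1 + g)) `^ b)^-1.
        rewrite powRM ?(ltW T0) ?invr_ge0 ?(ltW g0)// powRVl ?(ltW g0)//.
        by rewrite !invfM invrK !powRN.
      rewrite powRN lef_pV2 ?posrE ?(mulr_gt0 Sa0) ?powR_gt0//.
      rewrite /h -ab powRD; last by apply/implyP => _; rewrite gt_eqF.
      by rewrite ler_pM ?powR_ge0// ge0_ler_powR// ?nnegrE ?(ltW ST0) ?(ltW Tg0)//; lra.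
    rewrite lee_fin /c -!mulrA ler_wpM2l//.
    apply: (@le_trans _ _ ((1 + g) `^ (- q) * (S `^ (- a) * (T `^ (- b) * (1 + g) `^ b)))).
      by rewrite ler_wpM2l ?powR_ge0.
    rewrite mulrCA ler_wpM2l ?powR_ge0// mulrCA ler_wpM2l ?powR_ge0// -powRD; last first.
      by apply/implyP => _; rewrite gt_eqF.
    by rewrite ler_powR /q; lra.
  - move=> g; rewrite /= in_itv/= andbT => /negP; rewrite -ltNge => gB.
    by rewrite /phi -/B ifF//; apply/negbTE; rewrite -leNgt ltW.
rewrite integral_powR_tailZ//; last by lra.
have -> : 4 * k * S `^ (- a) * T `^ (- b) = c * 4 by rewrite /c; ring.
rewrite lee_fin (_ : 1 + (B - 1) = B); last by ring.
rewrite ler_wpM2l// ler_pdivrMr// (_ : 4 * (1 / 4) = 1); last by lra.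
by rewrite -[leRHS](powRr0 B) ler_powR; lra.
Qed.

End Phi.

Section Design.
Variable R : realType.

Lemma full_rank_row_mxl n p1 p2 (X1 : 'M[R]_(n, p1)) (X2 : 'M[R]_(n, p2)) :
  full_rank (row_mx X1 X2) -> full_rank X1.
Proof.
move=> fX v X1v; have := fX (col_mx v 0).
rewrite mul_row_col X1v mulmx0 addr0 => /(_ erefl) /eqP.
by rewrite col_mx_eq0 => /andP[/eqP].
Qed.

Lemma centered_width n p (X : 'M[R]_(n, p)) : (0 < n)%N -> \rank X = p ->
  (const_mx 1 : 'rV[R]_n) *m X = 0 -> (p < n)%N.
Proof.
move=> n0 rX oX; rewrite ltnNge; apply/negP => np.
have fr : row_free X.
  by rewrite /row_free eqn_leq rank_leq_row rX.
have : (const_mx 1 : 'rV[R]_n) = 0.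
  by apply: (row_free_inj fr); rewrite oX mul0mx.
move=> /matrixP /(_ 0 (Ordinal n0)); rewrite !mxE => /eqP.
by rewrite oner_eq0.
Qed.

Lemma fit_exists n p (X : 'M[R]_(n, p)) (e : 'cV[R]_n) : (0 < n)%N -> full_rank X ->
  (const_mx 1 : 'rV[R]_n) *m X = 0 ->
  exists (mu : R) (h : 'cV[R]_p) (r : 'cV[R]_n),
    [/\ e = mu *: const_mx 1 + X *m h + r, (const_mx 1 : 'rV[R]_n) *m r = 0 &
        X^T *m r = 0].
Proof.
move=> n0 fX oX; have [h [q [Eq Xq]]] := proj_exists e fX.
set o : 'rV[R]_n := const_mx 1 in oX *.
pose mu := (o *m q) 0 0 / n%:R.
have oT : (const_mx 1 : 'cV[R]_n) = o^T by rewrite trmx_const.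
exists mu, h, (q - mu *: const_mx 1); split.
- by rewrite Eq [_ + X *m h]addrC -addrA [_ + (q - _)]addrC subrK.
- have -> : o *m (q - mu *: const_mx 1) = o *m q - (mu * n%:R)%:M.
    rewrite mulmxBr -scalemxAr -scale_scalar_mx; congr (_ - _ *: _).
    apply/matrixP => i j; rewrite !ord1 !mxE (eq_bigr (fun _ => 1)) => [|k _].
      by rewrite sumr_const card_ord eqxx.
    by rewrite !mxE mulr1.
  by rewrite /mu divfK -?mx11_scalar ?subrr// pnatr_eq0 -lt0n.
- by rewrite mulmxBr Xq -scalemxAr oT -trmx_mul oX trmx0 scaler0 subr0.
Qed.

Lemma sqnD_le n (u v : 'cV[R]_n) : sqn (u + v) <= 2 * sqn u + 2 * sqn v.
Proof.
rewrite -subr_ge0; have -> : 2 * sqn u + 2 * sqn v - sqn (u + v) = sqn (u - v).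
  by rewrite /sqn !dotlin (dotC v u); ring.
exact: sqn_ge0.
Qed.

Lemma sqnD_ge n (u v : 'cV[R]_n) : sqn u / 2 - sqn v <= sqn (u + v).
Proof.
have := sqnD_le (u + v) (- v).
by rewrite addrK /(sqn (- v)) dotNl dotNr opprK -/(sqn v); lra.
Qed.

Lemma sqn_mulmx_le n p (A : 'M[R]_(n, p)) :
  exists C, 0 < C /\ forall v : 'cV[R]_p, sqn (A *m v) <= C * sqn v.
Proof.
pose C := \sum_i (\sum_j `|A i j|) ^+ 2.
have C0 : 0 <= C by apply: sumr_ge0 => i _; exact: sqr_ge0.
exists (C + 1); split; first by lra.
move=> v; have ev0 : 0 <= enorm v by exact: sqrtr_ge0.
have vj j : `|v j 0| <= enorm v.
  rewrite -ler_sqr ?nnegrE// enorm_sqr real_normK ?num_real//.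
  rewrite /sqn /dot (bigD1 j)//= -expr2 lerDl sumr_ge0// => i _.
  by rewrite -expr2 sqr_ge0.
apply: (@le_trans _ _ (C * sqn v)); last by rewrite ler_wpM2r ?sqn_ge0//; lra.
rewrite /C mulr_suml; apply: ler_sum => i _.
rewrite -expr2 -enorm_sqr -exprMn -[leLHS]real_normK ?num_real//.
rewrite ler_sqr ?nnegrE// ?mulr_ge0 ?sumr_ge0//.
rewrite mxE (le_trans (ler_norm_sum _ _ _))// mulr_suml ler_sum// => j _.
by rewrite normrM ler_wpM2l.
Qed.

Lemma full_rank_sqn_ge n p (X : 'M[R]_(n, p)) : full_rank X ->
  exists C, 0 < C /\ forall v : 'cV[R]_p, sqn v <= C * sqn (X *m v).
Proof.
move=> /gram_unit Gu.
have [C [C0 HC]] := sqn_mulmx_le (invmx (X^T *m X) *m X^T).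
exists C; split=> // v; have := HC (X *m v).
by rewrite -!mulmxA [X in invmx _ *m X]mulmxA mulKmx.
Qed.

Lemma ratio_fine_le (m1 m2 : \bar R) (lo up : R) : 0 < lo ->
  (lo%:E <= m1)%E -> (0 <= m2)%E -> (m2 <= up%:E)%E ->
  0 <= fine m2 / fine m1 <= up / lo.
Proof.
move=> lo0; case: m2 => [x2| |]//; rewrite !lee_fin => lo1 x20 xup.
have up0 : 0 <= up by exact: le_trans xup.
case: m1 lo1 => [x1| |] //=; last by rewrite invr0 mulr0 lexx divr_ge0// ltW.
rewrite lee_fin => lo1; have x10 : 0 < x1 by exact: lt_le_trans lo1.
rewrite divr_ge0 ?(ltW x10)//= ler_pM ?invr_ge0 ?(ltW x10)//.
by rewrite lef_pV2 ?posrE.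
Qed.

Lemma phi_ratio_cvg0 (n p1 p2 : nat) (S1 S2 k1 k2 K2 C1 C2 : R)
    (W T1 T2 : nat -> R) (m1 m2 : nat -> \bar R) :
  (0 < p2)%N -> (p1 + 2 < n)%N -> (p1 + p2 < n)%N ->
  0 <= S1 -> 0 <= S2 -> 0 < k1 -> 0 < k2 -> 0 < K2 ->
  W @ \oo --> +oo ->
  (forall N, T1 N <= 2 * W N + 2 * C1) ->
  (forall N, W N / 2 - C1 <= T1 N) -> (forall N, W N / 2 - C2 <= T2 N) ->
  (forall N, (0 < T1 N)%R ->
    \int[@lebesgue_measure R]_g phi n p1 S1 (T1 N) k1 g <= m1 N)%E ->
  (forall N, (0 < T2 N)%R ->
    \int[@lebesgue_measure R]_g phi n (p1 + p2) S2 (T2 N) k2 g <= m2 N /\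
    m2 N <= \int[@lebesgue_measure R]_g phi n (p1 + p2) S2 (T2 N) K2 g)%E ->
  (fun N => fine (m2 N) / fine (m1 N)) @ \oo --> 0.
Proof.
move=> p20 n12 pn S10 S20 k10 k20 K20 W_oo T1_le T1_ge T2_ge bounds1 bounds2.
have n0 : (0 < n)%N by apply: leq_ltn_trans n12.
have W_ge A : \forall N \near \oo, A <= W N by move/cvgryPge: W_oo; apply.
have T1_gt0 : \forall N \near \oo, 0 < T1 N.
  near=> N; apply: lt_le_trans (T1_ge N).
  have : 2 * C1 + 1 <= W N by near: N; exact: W_ge.
  by move=> ?; lra.
have T2_ge4 : \forall N \near \oo, 1 <= W N /\ W N / 4 <= T2 N.
  near=> N.
  have : 4 * C2 <= W N by near: N; exact: W_ge.
  have : 1 <= W N by near: N; exact: W_ge.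
  by have := T2_ge N; move=> ? ? ?; split=> //; lra.
have [S1E|S1N] := eqVneq S1 0.
  apply: cvg_near_cst; near=> N.
  have T10 : 0 < T1 N by near: N.
  have := bounds1 N T10; rewrite S1E integral_phi_infty ?leye_eq//; last by exact: ltnW.
  by move=> /eqP ->; rewrite invr0 mulr0.
have S1_gt0 : 0 < S1 by rewrite lt_def S1N.
have p1R : (p1 + 2)%:R + 1 <= n%:R :> R by rewrite natr1 ler_nat.
have p2R : 1 <= p2%:R :> R by rewrite ler1n.
have pnR : (p1 + p2)%:R + 1 <= n%:R :> R by rewrite natr1 ler_nat.
rewrite !natrD in p1R pnR.
have [/andP[/eqP S2E pn2]|nS2] := boolP ((S2 == 0) && (p1 + p2 + 2 <= n)%N).
  apply: cvg_near_cst; near=> N.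
  have [W1 T2W] : 1 <= W N /\ W N / 4 <= T2 N by near: N.
  have T20 : 0 < T2 N by lra.
  have [] := bounds2 N T20; rewrite S2E integral_phi_infty ?leye_eq//.
  by move=> /eqP -> _; rewrite mul0r.
have [a [b [a0 b0 abE bq [bp Sa]]]] : exists a b : R, [/\ 0 <= a, 0 <= b,
    a + b = (n%:R - 1) / 2, b + 5 / 4 <= ((p1 + p2)%:R + 3) / 2 &
    (p1%:R + 1) / 2 < b /\ (0 < S2 \/ a = 0)].
  have [pn2|pn2] := leqP (p1 + p2 + 2) n.
    have pn2R : (p1 + p2 + 2)%:R <= n%:R :> R by rewrite ler_nat.
    rewrite !natrD in pn2R.
    exists ((n%:R - (p1 + p2)%:R - 3 / 2) / 2), (((p1 + p2)%:R + 1 / 2) / 2).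
    rewrite natrD; have p1R0 : 0 <= p1%:R :> R by [].
    split; [lra|lra|lra|lra|split; first by lra].
    by left; move: nS2; rewrite pn2 andbT lt_def S20 andbT.
  have En : n = (p1 + p2).+1 by apply/eqP; rewrite eqn_leq pn andbT -ltnS -addn2.
  have nR : n%:R = p1%:R + p2%:R + 1 :> R by rewrite En -natr1 natrD.
  have p22 : (2 <= p2)%N by move: n12; rewrite En ltnS leq_add2l.
  have p22R : 2 <= p2%:R :> R by rewrite ler_nat.
  exists 0, ((n%:R - 1) / 2); rewrite natrD nR.
  have p1R0 : 0 <= p1%:R :> R by [].
  by split; [|lra|lra|lra|split; [lra|right]].
have [c [c0 Hc]] := integral_phi_ge p1 n0 S1_gt0 k10.
pose q := (p1%:R + 1) / 2 : R; have bq0 : 0 < b - q by rewrite subr_gt0.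
pose U := 4 * K2 * S2 `^ (- a).
have U0 : 0 <= U by rewrite !mulr_ge0 ?powR_ge0// ltW.
pose D := U * 4^-1 `^ (- b) / (c * 4 `^ (- q)).
have D_cvg : (fun N => D * W N `^ (- (b - q))) @ \oo --> 0.
  rewrite -(mulr0 D); apply: cvgMr.
  exact: cvg_comp W_oo (cvgr_powRN bq0).
apply: (squeeze_cvgr _ (cvg_cst 0) D_cvg); near=> N.
have [W1 T2W] : 1 <= W N /\ W N / 4 <= T2 N by near: N.
have T10 : 0 < T1 N by near: N.
have T20 : 0 < T2 N by lra.
have W0 : 0 < W N by lra.
have T1W : T1 N <= 4 * W N.
  have : C1 <= W N by near: N; exact: W_ge.
  by have := T1_le N; move=> ? ?; lra.
have WB : (p1.+1%:R)^-1 * (1 + n%:R) <= 4 * W N.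
  have : (p1.+1%:R)^-1 * (1 + n%:R) <= W N by near: N; exact: W_ge.
  by move=> /le_trans; apply; lra.
have W41 : 1 <= 4 * W N by lra.
have lo := le_trans (Hc _ _ (ltW T10) T1W W41 WB) (bounds1 N T10).
have [_ up1] := bounds2 N T20.
have up2 := le_trans up1 (integral_phi_le pn (ltW K20) S20 T20 a0 b0 abE bq Sa).
have m20 : (0 <= m2 N)%E.
  apply: le_trans (bounds2 N T20).1; apply: integral_ge0 => g _.
  by apply: phi_ge0; rewrite ltW.
have lo0 : 0 < c * (4 * W N) `^ (- q).
  by rewrite mulr_gt0// powR_gt0//; lra.
have /andP[-> /=] := ratio_fine_le lo0 lo m20 up2; move=> /le_trans; apply.
rewrite -/U.
apply: (@le_trans _ _ (U * (W N / 4) `^ (- b) / (c * (4 * W N) `^ (- q)))).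
  rewrite ler_pM2r ?invr_gt0// ler_wpM2l// !powRN lef_pV2 ?posrE ?powR_gt0//; last by lra.
  by rewrite ge0_ler_powR ?nnegrE//; lra.
have -> : W N `^ (- (b - q)) = W N `^ (- b) / W N `^ (- q).
  rewrite -powRB; last by apply/implyP => _; rewrite gt_eqF.
  by congr (_ `^ _); lra.
rewrite !powRM ?(ltW W0)// /D le_eqVlt; apply/predU1P; left.
have w0 := powR_gt0 (- q) W0; have f0 : 0 < 4 `^ (- q) :> R by rewrite powR_gt0.
by field; rewrite !gt_eqF.
Unshelve. all: by end_near. Qed.

End Design.

Theorem theorem3p4 (R : realType) (n p1 p2 : nat)
    (X1 : 'M[R]_(n, p1)) (X2 : 'M[R]_(n, p2))
    (alpha : R) (beta2 : 'cV[R]_p2) (eps : 'cV[R]_n)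
    (beta1 : nat -> 'cV[R]_p1) :
  (0 < p1)%N -> (0 < p2)%N ->
  \rank (row_mx X1 X2) = (p1 + p2)%N ->
  (const_mx 1 : 'rV[R]_n) *m row_mx X1 X2 = 0 ->
  (p1 + 2 < n)%N ->
  (fun N => enorm (beta1 N)) @ \oo --> +oo ->
  (fun N => bayes_factor (row_mx X1 X2) X1
      (alpha *: const_mx 1 + X1 *m beta1 N + X2 *m beta2 + eps)) @ \oo --> 0.
Proof.
move=> _ p20 rX oX n12 beta_oo; set X := row_mx X1 X2 in rX oX *.
have n0 : (0 < n)%N by apply: leq_ltn_trans n12.
have n1 : (1 < n)%N by apply: leq_ltn_trans n12; rewrite addn2.
have p1n : (p1 < n)%N by apply: leq_ltn_trans n12; rewrite leq_addr.
have pn : (p1 + p2 < n)%N by exact: centered_width n0 rX oX.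
have fX := full_rankP rX; have fX1 := full_rank_row_mxl fX.
have oX1 : (const_mx 1 : 'rV[R]_n) *m X1 = 0.
  by move: oX; rewrite /X mul_mx_row -row_mx0 => /eq_row_mx[].
pose e := X2 *m beta2 + eps.
have [mu1 [h1 [r1 [E1 or1 Xr1]]]] := fit_exists e n0 fX1 oX1.
have [mu2 [h2 [r2 [E2 or2 Xr2]]]] := fit_exists e n0 fX oX.
have [[k1 K1] /= [k10 K10 H1]] := marg_lik_bounds fX1 oX1 p1n n1.
have [[k2 K2] /= [k20 K20 H2]] := marg_lik_bounds fX oX pn n1.
pose y N := alpha *: const_mx 1 + X1 *m beta1 N + X2 *m beta2 + eps.
have Ey1 N : y N = (alpha + mu1) *: const_mx 1 + X1 *m (beta1 N + h1) + r1.
  rewrite /y -addrA -/e E1 mulmxDr scalerDl !addrA; congr (_ + _ + _).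
  by rewrite addrAC.
have Eb N : X *m (col_mx (beta1 N) 0 + h2) = X1 *m beta1 N + X *m h2.
  by rewrite mulmxDr /X mul_row_col mulmx0 addr0.
have Ey2 N : y N = (alpha + mu2) *: const_mx 1 + X *m (col_mx (beta1 N) 0 + h2) + r2.
  rewrite Eb /y -addrA -/e E2 scalerDl !addrA; congr (_ + _ + _).
  by rewrite addrAC.
pose W N := sqn (X1 *m beta1 N).
have W_oo : W @ \oo --> +oo.
  have [C [C0 HC]] := full_rank_sqn_ge fX1.
  apply/cvgryPge => A; near=> N.
  have b1 : 1 <= enorm (beta1 N) by near: N; move/cvgryPge: beta_oo; apply.
  have bA : A * C <= enorm (beta1 N) by near: N; move/cvgryPge: beta_oo; apply.
  rewrite -(ler_pM2r C0) mulrC [leRHS]mulrC; apply: le_trans (HC _).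
  rewrite mulrC; apply: (le_trans bA); rewrite -enorm_sqr expr2 ler_peMr//.
  exact: le_trans b1.
pose T1 N := sqn (X1 *m (beta1 N + h1)).
pose T2 N := sqn (X *m (col_mx (beta1 N) 0 + h2)).
have T1_le N : T1 N <= 2 * W N + 2 * sqn (X1 *m h1).
  by rewrite /T1 mulmxDr; exact: sqnD_le.
have T1_ge N : W N / 2 - sqn (X1 *m h1) <= T1 N by rewrite /T1 mulmxDr; exact: sqnD_ge.
have T2_ge N : W N / 2 - sqn (X *m h2) <= T2 N by rewrite /T2 Eb; exact: sqnD_ge.
have bounds1 N : 0 < T1 N ->
    (\int[@lebesgue_measure R]_g phi n p1 (sqn r1) (T1 N) k1 g <= marg_lik X1 (y N))%E.
  by move=> T10; rewrite Ey1; apply: (H1 _ _ _ or1 Xr1 _).1; rewrite ltr_wpDl// sqn_ge0.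
have bounds2 N : 0 < T2 N ->
    (\int[@lebesgue_measure R]_g phi n (p1 + p2) (sqn r2) (T2 N) k2 g <= marg_lik X (y N) /\
     marg_lik X (y N) <= \int[@lebesgue_measure R]_g phi n (p1 + p2) (sqn r2) (T2 N) K2 g)%E.
  by move=> T20; rewrite Ey2; apply: (H2 _ _ _ or2 Xr2 _); rewrite ltr_wpDl// sqn_ge0.
change ((fun N => fine (marg_lik X (y N)) / fine (marg_lik X1 (y N))) @ \oo --> (0 : R)).
exact: (phi_ratio_cvg0 p20 n12 pn (sqn_ge0 r1) (sqn_ge0 r2) k10 k20 K20 W_oo
  T1_le T1_ge T2_ge bounds1 bounds2).
Unshelve. all: by end_near. Qed.
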